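(* Let $\Bbbk$ be a field, let $G$ be a finite simple graph with vertex set $V=\{x_1,\dots,x_n\}$, $n\ge 1$, having no isolated vertices, and let $\mathcal C\subseteq V$ be a minimal vertex cover of $G$. Let $R=\Bbbk[x_1,\dots,x_n]$, $S=R[z]$, let $G(\mathcal C)$ be the $\mathcal C$-suspension of $G$ with new vertex $z$, and put $U=V\setminus\mathcal C$, $u=|U|$. Write $P_G(x)=(1+x)^{M(G)}\,q(1+x)$ with $q$ a polynomial, $q(0)\ne 0$. (a) If $M(G)<u$ then $M(G(\mathcal C))=M(G)$; if $M(G)>u$ then $M(G(\mathcal C))=u$; if $M(G)=u$ then $M(G(\mathcal C))\ge u$. Moreover, $M(G(\mathcal C))>u$ holds if and only if $M(G)=u$ and $q(0)=1$. (b) If $\mathfrak a(R/I(G))>-u$ then $\mathfrak a(S/I(G(\mathcal C)))=\mathfrak a(R/I(G))$, while if $\mathfrak a(R/I(G))<-u$ then $\mathfrak a(S/I(G(\mathcal C)))=-u$.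
   Context: For a finite simple graph $H$ whose vertices are identified with the variables of a polynomial ring over $\Bbbk$, the edge ideal $I(H)$ is the ideal generated by the products $uv$ over all edges $\{u,v\}$ of $H$. A vertex cover is a set of vertices meeting every edge; it is minimal if no proper subset is a vertex cover. The $\mathcal C$-suspension $G(\mathcal C)$ is obtained from $G$ by adjoining a new vertex $z$ joined to every vertex of $\mathcal C$ and to no other vertices; thus $I(G(\mathcal C))=I(G)+(zx_i:x_i\in\mathcal C)\subseteq S$. The independence polynomial of a graph $H$ is $P_H(x)=\sum_{i\ge 0} g_i x^i$ where $g_i$ is the number of independent sets (sets of pairwise non-adjacent vertices) of cardinality $i$ in $H$, with $g_0=1$. $M(H)$ denotes the multiplicity of $x=-1$ as a root of $P_H(x)$ ($0$ if $-1$ is not a root). For a standard graded $\Bbbk$-algebra $A$ of Krull dimension $d$ with Hilbert series $h_A(t)/(1-t)^d$, $h_A$ a polynomial, the $\mathfrak a$-invariant is $\mathfrak a(A)=\deg h_A(t)-d$. *)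

(* Defs.v *)
From HB Require Import structures.
From mathcomp Require Import all_boot all_order all_algebra.
From mathcomp Require Import generic_quotient ring_quotient.
From mathcomp Require Import boolp classical_sets mpoly.

Set Implicit Arguments.
Unset Strict Implicit.
Unset Printing Implicit Defensive.

Import GRing.Theory Num.Theory.
Local Open Scope ring_scope.
Local Open Scope quotient_scope.

(* A graph on the finite vertex type T is given by its adjacency relation;    *)
(* simplicity (symmetry, irreflexivity) is assumed where it is needed.        *)

Definition no_isolated (T : finType) (H : rel T) : Prop :=
  forall x, exists y, H x y.

Definition vertex_cover (T : finType) (H : rel T) (C : {set T}) : bool :=
  [forall x, forall y, H x y ==> (x \in C) || (y \in C)].

Definition minimal_vertex_cover (T : finType) (H : rel T) (C : {set T}) : bool :=
  minset (vertex_cover H) C.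

Definition independent (T : finType) (H : rel T) (A : {set T}) : bool :=
  [forall x in A, forall y in A, ~~ H x y].

Definition indep_poly (T : finType) (H : rel T) : {poly rat} :=
  \sum_(i < #|T|.+1)
     #|[set A : {set T} | independent H A & #|A| == i]|%:R *: 'X^i.

(* M(H); mup is 0 when -1 is not a root. *)
Definition indep_mult (T : finType) (H : rel T) : nat := mup (-1) (indep_poly H).

(* The vertices x_1, ..., x_n of G are embedded in 'I_n.+1 by lift ord_max    *)
(* (which preserves the value in nat); the new vertex z is ord_max.           *)
Definition suspension (n : nat) (G : rel 'I_n) (C : {set 'I_n}) : rel 'I_n.+1 :=
  fun a b => match unlift ord_max a, unlift ord_max b with
             | Some i, Some j => G i j
             | Some i, None => i \in C
             | None, Some j => j \in C
             | None, None => false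
             end.

Definition ideal_gen (R : comNzRingType) (X : R -> Prop) (p : R) : Prop :=
  exists s : seq (R * R),
    (forall x, x \in s -> X x.2) /\ p = \sum_(x <- s) x.1 * x.2.

Definition edge_monomial (k : fieldType) (n : nat) (H : rel 'I_n)
    (p : {mpoly k[n]}) : Prop :=
  exists i j, H i j /\ p = 'X_i * 'X_j.

(* Boolean-valued through excluded middle, as required by {ideal_quot _}. *)
Definition edge_ideal (k : fieldType) (n : nat) (H : rel 'I_n) :
    {pred {mpoly k[n]}} :=
  fun p => `[< ideal_gen (edge_monomial H) p >].
Arguments edge_ideal k {n} H _.

Lemma edge_ideal_closed (k : fieldType) (n : nat) (H : rel 'I_n) :
  idealr_closed (edge_ideal k H).
Proof.
split.
- by apply/asboolP; exists [::]; split=> //; rewrite big_nil.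
- apply/asboolP=> -[s [sX /(congr1 (meval (fun=> 0)))]].
  rewrite rmorph1 rmorph_sum big1_seq; first by move/eqP; rewrite oner_eq0.
  move=> x /andP[_ /sX [i [j [_ ->]]]].
  by rewrite !rmorphM /= !mevalXU mulr0 mulr0.
- move=> a p q /asboolP[s [sX ->]] /asboolP[t [tX ->]]; apply/asboolP.
  exists ([seq (a * x.1, x.2) | x <- s] ++ t); split.
    by move=> x; rewrite mem_cat => /orP[/mapP[y /sX ? ->]|/tX].
  rewrite big_cat big_map mulr_sumr; congr (_ + _).
  by apply: eq_bigr => x _; rewrite mulrA.
Qed.

HB.instance Definition _ (k : fieldType) (n : nat) (H : rel 'I_n) :=
  isIdealr.Build {mpoly k[n]} (edge_ideal k H) (edge_ideal_closed k H).

(* The k-algebra k[x_1, ..., x_n] / I(H). *)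
Definition edge_ring (k : fieldType) (n : nat) (H : rel 'I_n) : Type :=
  {ideal_quot (edge_ideal k H)}.
Arguments edge_ring k {n} H.

HB.instance Definition _ (k : fieldType) (n : nat) (H : rel 'I_n) :=
  GRing.ComNzRing.on (edge_ring k H).

Section EdgeRing.
Variables (k : fieldType) (n : nat) (H : rel 'I_n).

Definition edge_proj (p : {mpoly k[n]}) : edge_ring k H :=
  \pi_{ideal_quot (edge_ideal k H)} p.

Lemma edge_proj_is_zmod_morphism : zmod_morphism edge_proj.
Proof. exact: raddfB. Qed.

Lemma edge_proj_is_monoid_morphism : monoid_morphism edge_proj.
Proof. by split; [exact: rmorph1 | exact: rmorphM]. Qed.

HB.instance Definition _ :=
  GRing.isZmodMorphism.Build {mpoly k[n]} (edge_ring k H) edge_proj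
    edge_proj_is_zmod_morphism.
HB.instance Definition _ :=
  GRing.isMonoidMorphism.Build {mpoly k[n]} (edge_ring k H) edge_proj
    edge_proj_is_monoid_morphism.

Definition edge_scale (c : k) (a : edge_ring k H) : edge_ring k H :=
  edge_proj c%:MP * a.

Lemma edge_scaleA a b v : edge_scale a (edge_scale b v) = edge_scale (a * b) v.
Proof. by rewrite /edge_scale mpolyCM rmorphM mulrA. Qed.

Lemma edge_scale1 : left_id 1 edge_scale.
Proof. by move=> v; rewrite /edge_scale mpolyC1 rmorph1 mul1r. Qed.

Lemma edge_scaleDr : right_distributive edge_scale +%R.
Proof. by move=> c u v; rewrite /edge_scale mulrDr. Qed.

Lemma edge_scaleDl v : {morph edge_scale^~ v : a b / a + b}.
Proof. by move=> a b; rewrite /edge_scale mpolyCD rmorphD mulrDl. Qed.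

HB.instance Definition _ :=
  GRing.Zmodule_isLmodule.Build k (edge_ring k H)
    edge_scaleA edge_scale1 edge_scaleDr edge_scaleDl.

Lemma edge_scaleAl (c : k) (u v : edge_ring k H) : c *: (u * v) = (c *: u) * v.
Proof. exact: mulrA. Qed.

HB.instance Definition _ :=
  GRing.Lmodule_isLalgebra.Build k (edge_ring k H) edge_scaleAl.
HB.instance Definition _ :=
  GRing.Lalgebra_isComAlgebra.Build k (edge_ring k H).

(* The component of degree i of the standard grading. *)
Definition edge_ring_degree (i : nat) (a : edge_ring k H) : Prop :=
  exists2 p : {mpoly k[n]}, p \is i.-homog & a = edge_proj p.

End EdgeRing.

(* The set W is an r-dimensional subspace of V: it is the span of r linearly  *)
(* independent vectors.                                                       *)
Definition has_dimension (k : fieldType) (V : lmodType k) (W : V -> Prop)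
    (r : nat) : Prop :=
  exists b : 'I_r -> V,
    (forall v, W v <-> exists c : 'I_r -> k, v = \sum_j c j *: b j) /\
    (forall c : 'I_r -> k, \sum_j c j *: b j = 0 -> forall j, c j = 0).

Definition is_hilbert_function (k : fieldType) (A : comAlgType k)
    (deg : nat -> A -> Prop) (HF : nat -> nat) : Prop :=
  forall i, has_dimension (deg i) (HF i).

Definition prime_ideal (A : comNzRingType) (P : {pred A}) : Prop :=
  idealr_closed P /\ prime_idealr_closed P.

Definition prime_chain (A : comNzRingType) (d : nat) (P : nat -> {pred A}) :
    Prop :=
  (forall i, (i <= d)%N -> prime_ideal (P i)) /\
  (forall i, (i < d)%N ->
     {subset P i <= P i.+1} /\ ~ {subset P i.+1 <= P i}).

Definition is_krull_dim (A : comNzRingType) (d : nat) : Prop :=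
  (exists P : nat -> {pred A}, prime_chain d P) /\
  (forall e (P : nat -> {pred A}), prime_chain e P -> (e <= d)%N).

(* sum_i HF(i) t^i = h(t) / (1 - t)^d, i.e. the Cauchy product of             *)
(* (1 - t)^d with the power series on the left is h(t).                       *)
Definition is_hilbert_numerator (HF : nat -> nat) (d : nat) (h : {poly int}) :
    Prop :=
  forall m : nat,
    \sum_(j < m.+1) ((1 - 'X) ^+ d : {poly int})`_j * (HF (m - j)%N)%:Z = h`_m.

(* deg h = (size h).-1; here h <> 0, since A <> 0. *)
Definition is_a_invariant (k : fieldType) (A : comAlgType k)
    (deg : nat -> A -> Prop) (a : int) : Prop :=
  exists (HF : nat -> nat) (d : nat) (h : {poly int}),
    [/\ is_hilbert_function deg HF, is_krull_dim A d,
        is_hilbert_numerator HF d h & a = (size h).-1%:Z - d%:Z].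

(* The a-invariant of the algebra A with graded components deg i; it exists   *)
(* and is unique for standard graded algebras (Hilbert-Serre).                *)
Definition a_invariant (k : fieldType) (A : comAlgType k)
    (deg : nat -> A -> Prop) : int :=
  xget 0 (is_a_invariant deg).

Definition edge_a_invariant (k : fieldType) (n : nat) (H : rel 'I_n) : int :=
  a_invariant (@edge_ring_degree k n H).
Arguments edge_a_invariant k {n} H.

(* Main.v *)
(* Splitting the independent sets of G(C) according to whether they contain   *)
(* z gives P_{G(C)} = P_G + x (1 + x)^u, which yields (a) by comparing the    *)
(* orders of vanishing at -1.                                                 *)
(*                                                                            *)
(* Part (b) reduces to (a) through the identity a(k[V]/I(H)) = - M(H). The    *)
(* monomials with independent support form a basis of k[V]/I(H), so its       *)
(* Hilbert series is P_H(t / (1 - t)), and its Krull dimension is the largest *)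
(* size d of an independent set; hence h(t) = (1 - t)^d P_H(t / (1 - t)).     *)
(* Writing P_H(x) = (1 + x)^M q(1 + x), the substitution 1 + x = 1 / (1 - t)  *)
(* turns this into (1 - t)^(d - M) q(1 / (1 - t)), of degree d - M.           *)
(*                                                                            *)
(* The upper bound on the Krull dimension follows Coquand and Lombardi: if    *)
(* x_i lies in P_(i+1) but not in P_i for a chain of primes P_0, ..., P_m,    *)
(* then x_0, ..., x_(m-1) are algebraically independent over k, while the     *)
(* growth of the Hilbert function makes any d + 1 elements dependent.         *)

From HB Require Import structures.
Require Import Defs.
From mathcomp Require Import boolp mpoly.
From mathcomp Require Import all_boot all_order all_algebra.
From mathcomp Require Import generic_quotient ring_quotient.

Set Implicit Arguments.
Unset Strict Implicit.
Unset Printing Implicit Defensive.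

Import GRing.Theory Num.Theory.
Local Open Scope ring_scope.

(** With y = 1 + x, [indep_poly_suspension] reads P_{G(C)} = y^M q(y) + (y - 1) y^u. The second
    summand vanishes at y = 0 to order exactly u, with lowest coefficient -1, so the lowest terms
    can cancel only if M = u and q(0) = 1; this is [indep_mult_suspension], which is (a).

    For (b), [edge_a_invariantE] replaces both a-invariants by -M(H). The Hilbert series comes from
    [edge_ring_degree_dim] and [box_hilbert_numerator], the dimension d from [edge_ring_krull_dim],
    and the degree d - M of the numerator from [size_indep_hvector]: its top coefficient is q(0) up
    to sign. *)

(** * The independence polynomial of a suspension and its order at -1 *)

Lemma indep_polyE (T : finType) (H : rel T) :
  indep_poly H = \sum_(A : {set T} | independent H A) 'X^#|A|.
Proof.
have cardlt (A : {set T}) : (#|A| < #|T|.+1)%N by rewrite ltnS max_card.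
rewrite /indep_poly (partition_big (fun A => Ordinal (cardlt A)) predT) //=.
apply: eq_bigr => i _.
rewrite (eq_bigr (fun=> 'X^i)); last by move=> A /andP[_ /eqP <-].
rewrite sumr_const -scaler_nat; congr (_%:R *: _).
by rewrite cardsE; apply: eq_card => A; rewrite !unfold_in.
Qed.

Lemma sum_exp_subset (R : comNzRingType) (T : finType) (D : {set T}) (x : R) :
  \sum_(B : {set T} | B \subset D) x ^+ #|B| = (1 + x) ^+ #|D|.
Proof.
rewrite -prodr_const [RHS]big_mkcond /=.
(* The factor 0 + 1 outside [D] lets the expansion run over all subsets of [T]; those not inside [D]
   contribute 0. *)
rewrite (eq_bigr (fun i => (if i \in D then x else 0) + 1)); last first.
  by move=> i _; case: (i \in D); rewrite ?add0r // addrC.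
rewrite bigA_distr [LHS]big_mkcond /=; apply: eq_bigr => B _.
rewrite -big_mkcond /=; case: ifPn => [BD|/subsetPn[i iB iD]].
  by rewrite -prodr_const; apply: eq_bigr => i /(subsetP BD) ->.
by rewrite (bigD1 i) //= (negPf iD) mul0r.
Qed.

(** An independent set containing z is z together with a subset of the complement of [C]. Every such
    subset occurs, because the complement of a cover is independent. *)
Lemma indep_poly_suspension (n : nat) (G : rel 'I_n) (C : {set 'I_n}) :
  vertex_cover G C ->
  indep_poly (suspension G C) = indep_poly G + 'X * (1 + 'X) ^+ #|~: C|.
Proof.
move=> /forallP cov; pose l : 'I_n -> 'I_n.+1 := lift ord_max.
have l_inj : injective l := @lift_inj _ _.
have maxl (B : {set 'I_n}) : ord_max \notin l @: B.
  by apply/imsetP=> -[i _ /eqP]; rewrite (negPf (neq_lift _ _)).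
have sll i j : suspension G C (l i) (l j) = G i j.
  by rewrite /suspension !liftK.
have slm i : suspension G C (l i) ord_max = (i \in C).
  by rewrite /suspension liftK unlift_none.
have sml i : suspension G C ord_max (l i) = (i \in C).
  by rewrite /suspension liftK unlift_none.
have smm : suspension G C ord_max ord_max = false.
  by rewrite /suspension unlift_none.
have indl (B : {set 'I_n}) :
    independent (suspension G C) (l @: B) = independent G B.
  apply/forall_inP/forall_inP => [ind x xB|ind _ /imsetP[x xB ->]].
    apply/forall_inP => y yB; rewrite -sll.
    exact: (forall_inP (ind _ (imset_f _ xB)) _ (imset_f _ yB)).
  apply/forall_inP=> _ /imsetP[y yB ->]; rewrite sll.
  exact: (forall_inP (ind _ xB) _ yB).
have indm (B : {set 'I_n}) : independent (suspension G C) (ord_max |: l @: B) =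
    (B \subset ~: C).
  apply/forall_inP/subsetP => [ind x xB|sub a].
    have lx : l x \in ord_max |: l @: B by rewrite inE imset_f ?orbT.
    have := forall_inP (ind _ lx) _ (setU11 _ _).
    by rewrite slm in_setC.
  move=> aB; apply/forall_inP=> b; move: aB.
  case/setU1P=> [->|/imsetP[x xB ->]]; case/setU1P=> [->|/imsetP[y yB ->]].
  - by rewrite smm.
  - by rewrite sml -in_setC sub.
  - by rewrite slm -in_setC sub.
  (* An edge with both ends outside [C] would be uncovered. *)
  rewrite sll; apply/negP=> Gxy.
  have /forallP/(_ y)/implyP/(_ Gxy)/orP := cov x.
  by move: (sub _ xB) (sub _ yB); rewrite !in_setC => /negP ? /negP ? [].
have lpre (B : {set 'I_n}) : l @^-1: (l @: B) = B.
  by apply/setP=> i; rewrite inE mem_imset.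
have unl (a : 'I_n.+1) : a != ord_max -> exists i, a = l i.
  by rewrite eq_sym => /unlift_some[i -> _]; exists i.
rewrite !indep_polyE (bigID (fun A : {set _} => ord_max \in A)) /= [LHS]addrC.
congr (_ + _).
  rewrite (reindex_onto (fun B : {set 'I_n} => l @: B) (fun A => l @^-1: A)) /=;
    last first.
    move=> A /andP[_ mA]; apply/setP=> a; apply/imsetP/idP.
      by case=> i; rewrite inE => ? ->.
    move=> aA; have /unl[i ai] : a != ord_max by apply: contraTneq aA => ->.
    by exists i; rewrite // inE -ai.
  apply: eq_big => B; first by rewrite indl maxl lpre eqxx !andbT.
  by rewrite card_imset.
rewrite (reindex_onto (fun B : {set 'I_n} => ord_max |: l @: B)
    (fun A => l @^-1: A)) /=.
  rewrite -sum_exp_subset mulr_sumr; apply: eq_big => B.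
    rewrite indm setU11 andbT -[RHS]andbT; congr (_ && _).
    rewrite -[X in _ == X]lpre; apply/eqP/setP => i; rewrite !inE.
    by rewrite eq_sym (negPf (neq_lift _ _)).
  by rewrite cardsU1 maxl card_imset // exprS.
move=> A /andP[_ mA]; apply/setP=> a; apply/setU1P/idP.
  by case=> [->//|/imsetP[i]]; rewrite inE => ? ->.
move=> aA; have [->|/unl[i ai]] := eqVneq a ord_max; [by left | right].
by apply/imsetP; exists i; rewrite // inE -ai.
Qed.

Lemma independent_set0 (T : finType) (H : rel T) : independent H set0.
Proof. by apply/forall_inP=> x; rewrite inE. Qed.

Lemma indep_poly_at0 (T : finType) (H : rel T) : (indep_poly H).[0] = 1.
Proof.
rewrite indep_polyE horner_sum (bigD1 set0) ?independent_set0 //=.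
rewrite cards0 hornerXn expr0.
rewrite big1 ?addr0 // => A /andP[_ A0].
by rewrite hornerXn expr0n cards_eq0 (negPf A0).
Qed.

Lemma indep_poly_neq0 (T : finType) (H : rel T) : indep_poly H != 0.
Proof.
apply: contra_eq_neq (indep_poly_at0 H) => ->.
by rewrite horner0 eq_sym oner_eq0.
Qed.

Lemma mup_expM (m : nat) (r : {poly rat}) :
  r.[-1] != 0 -> mup (-1) ((1 + 'X) ^+ m * r) = m.
Proof.
move=> r1; rewrite mupMl //.
have -> : 1 + 'X = 'X - (-1)%:P :> {poly rat} by rewrite polyCN opprK addrC.
by rewrite mup_XsubCX eqxx.
Qed.

Lemma mup_ge_expM (m : nat) (r : {poly rat}) :
  r != 0 -> (m <= mup (-1) ((1 + 'X) ^+ m * r))%N.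
Proof.
have -> : 1 + 'X = 'X - (-1)%:P :> {poly rat} by rewrite polyCN opprK addrC.
move=> r0; rewrite mup_geq ?dvdp_mulr // mulf_neq0 //.
by rewrite expf_neq0 ?polyXsubC_eq0.
Qed.

(** Factor out the smaller power of 1 + X. At -1 the cofactor takes the value q(0) if M < u, -1 if M
    > u, and q(0) - 1 if M = u. *)
Lemma indep_mult_suspension (n : nat) (G : rel 'I_n) (C : {set 'I_n})
    (q : {poly rat}) (M := indep_mult G) (u := #|~: C|)
    (M' := indep_mult (suspension G C)) :
  vertex_cover G C ->
  indep_poly G = (1 + 'X) ^+ M * (q \Po (1 + 'X)) -> q.[0] != 0 ->
  [/\ (M < u)%N -> M' = M, (u < M)%N -> M' = u, M = u -> (u <= M')%N
    & (u < M')%N <-> (M = u /\ q.[0] = 1)].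
Proof.
move=> cov hq q0; have P'0 := indep_poly_neq0 (suspension G C).
have X1 : (1 + 'X : {poly rat}) = 'X - (-1)%:P by rewrite polyCN opprK addrC.
have ev : 1 + -1 = 0 :> rat by rewrite subrr.
have lt : (M < u)%N -> M' = M.
  move=> Mu; rewrite /M' /indep_mult indep_poly_suspension // hq -/u.
  rewrite -(subnKC Mu) addSnnS exprD mulrCA -mulrDr mup_expM //.
  by rewrite !hornerE horner_comp !hornerE ev expr0n /= mulr0 addr0.
have gt : (u < M)%N -> M' = u.
  move=> uM; rewrite /M' /indep_mult indep_poly_suspension // hq -/u.
  rewrite -(subnKC uM) addSnnS exprD (mulrC 'X) -mulrA -mulrDr mup_expM //.
  rewrite !hornerE horner_comp !hornerE ev expr0n /= mul0r add0r.
  by rewrite oppr_eq0 oner_eq0.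
have E : M = u -> indep_poly (suspension G C) =
    (1 + 'X) ^+ u * ((q \Po (1 + 'X)) + 'X).
  by move=> Mu; rewrite indep_poly_suspension // hq -/u Mu mulrDr (mulrC 'X).
have r0 : M = u -> (q \Po (1 + 'X)) + 'X != 0.
  by move=> /E E0; move: P'0; rewrite E0; apply: contraNneq => ->;
    rewrite mulr0.
have eq : M = u -> (u <= M')%N.
  by move=> Mu; rewrite /M' /indep_mult E // mup_ge_expM // r0.
split=> //; split=> [uM'|[Mu q1]].
  case: (ltngtP M u) => [h|h|h].
  - by move: uM'; rewrite lt // ltnNge ltnW.
  - by move: uM'; rewrite gt // ltnn.
  split=> //; apply/eqP; apply: contraLR uM' => q1; rewrite -leqNgt.
  rewrite /M' /indep_mult E // mup_expM // !hornerE horner_comp !hornerE ev.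
  by rewrite subr_eq0.
rewrite /M' /indep_mult mup_geq // E // exprSr -X1 dvdp_mul2l; last first.
  by rewrite expf_neq0 // X1 polyXsubC_eq0.
by rewrite X1 dvdp_XsubCl /root -X1 !hornerE horner_comp !hornerE ev q1 subrr.
Qed.

(** * The h-polynomial of the independence complex and its degree *)

Definition indep_number (T : finType) (H : rel T) : nat :=
  \max_(A : {set T} | independent H A) #|A|.

(** The polynomial (1 - t)^d P_H(t / (1 - t)) with denominators cleared. The ring is a parameter
    because Hilbert numerators live over [int] while P_H lives over [rat]. *)
Definition indep_hvector (R : nzRingType) (T : finType) (H : rel T) :
    {poly R} :=
  \sum_(A : {set T} | independent H A)
     'X^#|A| * (1 - 'X) ^+ (indep_number H - #|A|).

Lemma leq_indep_number (T : finType) (H : rel T) (A : {set T}) :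
  independent H A -> (#|A| <= indep_number H)%N.
Proof. by move=> indA; apply: (bigmax_sup A). Qed.

Lemma indep_numberP (T : finType) (H : rel T) :
  exists2 A : {set T}, independent H A & #|A| = indep_number H.
Proof.
have [A indA ->] : {A : {set T} | independent H A & indep_number H = #|A|}.
  apply: eq_bigmax_cond; apply/card_gt0P; exists set0.
  exact: independent_set0.
by exists A.
Qed.

Lemma size_indep_poly (T : finType) (H : rel T) :
  size (indep_poly H) = (indep_number H).+1.
Proof.
have [A indA cardA] := indep_numberP H.
apply/eqP; rewrite eqn_leq; apply/andP; split.
  rewrite indep_polyE; apply: (leq_trans (size_sum _ _ _)).
  by apply/bigmax_leqP=> B indB; rewrite size_polyXn ltnS leq_indep_number.
rewrite ltnNge; apply/negP=> /leq_sizeP/(_ _ (leqnn _))/eqP.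
rewrite /indep_poly -(poly_def #|T|.+1
  (fun i => #|[set A : {set T} | independent H A & #|A| == i]|%:R)).
rewrite coef_poly -cardA ltnS max_card pnatr_eq0 cards_eq0.
by apply/negP/set0Pn; exists A; rewrite inE indA eqxx.
Qed.

Section Homogenize.
Variables (R : comNzRingType) (d : nat).

(** For deg p <= d this is (1 - X)^d p(X / (1 - X)). *)
Definition homogenize (p : {poly R}) : {poly R} :=
  \sum_(i < d.+1) p`_i *: ('X^i * (1 - 'X) ^+ (d - i)).

Lemma homogenize_is_linear : linear homogenize.
Proof.
move=> a p q; rewrite /homogenize scaler_sumr -big_split /=.
by apply: eq_bigr => i _; rewrite coefD coefZ scalerDl scalerA.
Qed.

HB.instance Definition _ :=
  GRing.isLinear.Build R {poly R} {poly R} _ homogenize homogenize_is_linear.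

Lemma homogenizeXn j :
  (j <= d)%N -> homogenize 'X^j = 'X^j * (1 - 'X) ^+ (d - j).
Proof.
rewrite -ltnS => jd; rewrite /homogenize (bigD1 (Ordinal jd)) //=.
rewrite coefXn eqxx scale1r big1 ?addr0 // => i ij.
by rewrite coefXn (negPf (_ : i != j :> nat)) ?scale0r.
Qed.

(* Homogenizing [1 + X] to [X + (1 - X) = 1]. *)
Lemma homogenize_exp1DX j :
  (j <= d)%N -> homogenize ((1 + 'X) ^+ j) = (1 - 'X) ^+ (d - j).
Proof.
move=> jd; rewrite exprDn linear_sum /=.
transitivity (((1 - 'X) + 'X) ^+ j * (1 - 'X) ^+ (d - j) : {poly R});
    last first.
  by rewrite addrNK expr1n mul1r.
rewrite exprDn mulr_suml; apply: eq_bigr => i _.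
have ij : (i <= j)%N by rewrite -ltnS.
rewrite expr1n mul1r linearMn /= homogenizeXn ?(leq_trans ij) //.
rewrite mulrnAl; congr (_ *+ _).
rewrite mulrAC mulrC -exprD; congr (_ * _ ^+ _).
by rewrite addnC addnBA // subnK.
Qed.

End Homogenize.

Lemma indep_hvectorE (T : finType) (H : rel T) :
  indep_hvector rat H = homogenize (indep_number H) (indep_poly H).
Proof.
rewrite indep_polyE linear_sum; apply: eq_bigr => A indA /=.
by rewrite homogenizeXn // leq_indep_number.
Qed.

Lemma indep_poly_factor (T : finType) (H : rel T) :
  exists2 q : {poly rat},
    indep_poly H = (1 + 'X) ^+ indep_mult H * (q \Po (1 + 'X)) & q.[0] != 0.
Proof.
have [m [r]] := multiplicity_XsubC (indep_poly H) (-1).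
rewrite indep_poly_neq0 /= polyCN opprK => r1 hr.
have rE : (r \Po ('X - 1)) \Po (1 + 'X) = r.
  rewrite -comp_polyA comp_polyB comp_polyX comp_polyC addrC addKr.
  exact: comp_polyXr.
have mE : indep_mult H = m.
  by rewrite /indep_mult hr addrC mulrC mup_expM.
exists (r \Po ('X - 1)); first by rewrite rE mE {1}hr mulrC addrC.
by rewrite horner_comp !hornerE.
Qed.

(** Let s = deg q, so d = M + s. Homogenizing sends (1 + X)^(M + i) to (1 - X)^(s - i), hence the
    h-polynomial is the reversal of q evaluated at 1 - X; it has degree s because q(0) is
    nonzero. *)
Lemma size_indep_hvector (T : finType) (H : rel T) :
  (indep_mult H <= indep_number H)%N /\
  size (indep_hvector int H) = (indep_number H - indep_mult H).+1.
Proof.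
have [q hq q0] := indep_poly_factor H.
have q_neq0 : q != 0 by apply: contraNneq q0 => ->; rewrite horner0.
have X1 : 1 + 'X = 'X - (-1)%:P :> {poly rat} by rewrite polyCN opprK addrC.
have size1X : size (1 + 'X : {poly rat}) = 2%N by rewrite X1 size_XsubC.
have /prednK size_q : (0 < size q)%N by rewrite size_poly_gt0.
set s := (size q).-1 in size_q.
have dE : (indep_number H = indep_mult H + s)%N.
  apply: succn_inj; rewrite -addnS size_q -size_indep_poly hq.
  rewrite size_mul; last 2 first.
  - by rewrite expf_neq0 // -size_poly_gt0 size1X.
  - by rewrite -size_poly_gt0 size_comp_poly2 // size_poly_gt0.
  by rewrite size_comp_poly2 // {1}X1 size_exp_XsubC -size_q addSn.
split; first by rewrite dE leq_addr.
have -> : size (indep_hvector int H) = size (indep_hvector rat H).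
  rewrite -(size_map_inj_poly (@intr_inj rat)) //; congr (size (polyseq _)).
  rewrite /indep_hvector rmorph_sum; apply: eq_bigr => A _ /=.
  by rewrite rmorphM !rmorphXn rmorphB rmorph1 /= map_polyX.
rewrite indep_hvectorE hq dE.
rewrite {1}(_ : q = \sum_(i < s.+1) q`_i *: 'X^i); last first.
  by rewrite size_q -poly_def coefK.
rewrite linear_sum mulr_sumr linear_sum /=.
rewrite (eq_bigr (fun i : 'I_s.+1 => q`_i *: (1 - 'X) ^+ (s - i))); last first.
  move=> i _; rewrite linearZ /= comp_Xn_poly -scalerAr -exprD linearZ /=.
  rewrite homogenize_exp1DX ?subnDl // leq_add2l -ltnS.
  exact: ltn_ord.
have size1X' : size (1 - 'X : {poly rat}) = 2%N.
  by rewrite -opprB size_polyN size_XsubC.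
rewrite (_ : \sum_(i < _) _ = (\poly_(i < s.+1) q`_(s - i)) \Po (1 - 'X)).
  rewrite size_comp_poly2 // size_poly_eq ?subnn -?horner_coef0 //.
  by rewrite addKn.
rewrite poly_def linear_sum (reindex_inj rev_ord_inj) /=.
apply: eq_bigr => i _; rewrite linearZ /= comp_Xn_poly subSS subKn //.
by rewrite -ltnS.
Qed.

(** * Counting monomials with independent support *)

Definition mnm_supp (n : nat) (m : 'X_{1..n}) : {set 'I_n} :=
  [set i | m i != 0%N].

(* Exponents are bounded by L so that only finitely many monomials occur;     *)
(* the choice of L does not matter in degrees at most L.                      *)
Definition box_mnm (n L : nat) (e : {ffun 'I_n -> 'I_L.+1}) : 'X_{1..n} :=
  [multinom (e i : nat) | i < n].

Definition indep_box (n : nat) (H : rel 'I_n) (L : nat) :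
    {set {ffun 'I_n -> 'I_L.+1}} :=
  [set e | independent H (mnm_supp (box_mnm e))].

Definition box_hilbert (n : nat) (H : rel 'I_n) (L i : nat) : nat :=
  #|[set e in indep_box H L | mdeg (box_mnm e) == i]|.

Lemma box_mnm_inj (n L : nat) : injective (@box_mnm n L).
Proof.
move=> e f /mnmP ef; apply/ffunP=> i; apply: val_inj.
by have := ef i; rewrite !mnmE.
Qed.

Lemma box_mnmP (n L : nat) (m : 'X_{1..n}) :
  (mdeg m <= L)%N -> exists e : {ffun 'I_n -> 'I_L.+1}, box_mnm e = m.
Proof.
move=> mL; exists [ffun i => inord (m i)]; apply/mnmP=> i.
rewrite mnmE ffunE inordK // ltnS (leq_trans _ mL) //.
by rewrite mdegE (bigD1 i) //= leq_addr.
Qed.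

(** A monomial with support [A] amounts to a free choice of an exponent from 1 to L at each vertex
    of [A], so the sum factors. *)
Lemma sum_box_supp (R : comNzSemiRingType) (n L : nat) (A : {set 'I_n})
    (w : nat -> R) :
  \sum_(e : {ffun 'I_n -> 'I_L.+1} | mnm_supp (box_mnm e) == A)
     \prod_(i in A) w (e i) = (\sum_(j < L) w j.+1) ^+ #|A|.
Proof.
rewrite -prodr_const.
rewrite [RHS](eq_bigr (fun=> \sum_(j < L.+1 | j != ord0) w j)); last first.
  by move=> i _; rewrite [RHS]big_mkcond big_ord_recl /= add0r.
rewrite (big_distr_big_dep ord0); apply: eq_bigl => e.
apply/eqP/pfamilyP=> [<-|[/supportP sub nz]].
  split=> [|i]; last by rewrite inE mnmE => ?; rewrite unfold_in.
  apply/supportP=> i; rewrite inE negbK mnmE => /eqP i0.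
  exact: val_inj.
apply/setP=> i; rewrite inE mnmE.
by case: (boolP (i \in A)) => [/nz|/sub ->].
Qed.

Lemma sum_box_mdeg (R : comNzRingType) (n : nat) (H : rel 'I_n) (L : nat) :
  \sum_(e in indep_box H L) 'X^(mdeg (box_mnm e)) =
  \sum_(A : {set 'I_n} | independent H A)
     (\sum_(j < L) 'X^(j.+1)) ^+ #|A| :> {poly R}.
Proof.
rewrite (partition_big (fun e => mnm_supp (box_mnm e)) (independent H)) /=.
  apply: eq_bigr => A indA; rewrite -sum_box_supp.
  apply: eq_big => [e|e /andP[_ /eqP <-]].
    by rewrite inE andb_idl // => /eqP ->.
  rewrite mdegE expr_sum [RHS]big_mkcond; apply: eq_bigr => i _.
  by rewrite inE mnmE; case: eqP => // ->.
by move=> e; rewrite inE.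
Qed.

(** There are at most 2^n supports, each carrying at most L^d exponent vectors when L > 0. This
    O(L^d) growth is what bounds the Krull dimension. *)
Lemma card_indep_box (n : nat) (H : rel 'I_n) (L : nat) :
  (#|indep_box H L| <= 2 ^ n * L.+1 ^ indep_number H)%N.
Proof.
rewrite -sum1_card.
rewrite (partition_big (fun e => mnm_supp (box_mnm e)) (independent H)) /=;
    last first.
  by move=> e; rewrite inE.
apply: (@leq_trans (\sum_(A : {set 'I_n}) L.+1 ^ indep_number H)); last first.
  by rewrite sum_nat_const -cardsT -powersetT card_powerset cardsT card_ord.
rewrite [X in (_ <= X)%N](bigID (independent H)) /=.
apply: leq_trans (leq_addr _ _); apply: leq_sum => A indA.
apply: (@leq_trans (L ^ #|A|)); last first.
  apply: (@leq_trans (L.+1 ^ #|A|)).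
    by case: (posnP #|A|) => [-> //|A0]; rewrite leq_exp2r.
  by rewrite leq_pexp2l // leq_indep_number.
(* Constant weight 1 turns the weighted sum into a count. *)
have := sum_box_supp L A (fun=> 1%N).
rewrite [LHS](eq_bigr (fun=> 1%N)) => [|e _]; last by rewrite big1.
rewrite [X in _ = X ^+ _]sumr_const card_ord natrXE natn => <-.
apply: eq_leq; apply: eq_bigl => e; rewrite inE andb_idl // => /eqP ->.
exact: indA.
Qed.

Lemma coef_sum_box (R : comNzRingType) (n : nat) (H : rel 'I_n) (L i : nat) :
  (\sum_(e in indep_box H L) 'X^(mdeg (box_mnm e)) : {poly R})`_i =
  (box_hilbert H L i)%:R.
Proof.
rewrite coef_sum (eq_bigr (fun e => (mdeg (box_mnm e) == i)%:R)); last first.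
  by move=> e _; rewrite coefXn eq_sym.
rewrite -natr_sum /box_hilbert -sum1_card; congr _%:R.
rewrite big_mkcond [RHS]big_mkcond; apply: eq_bigr => e _; rewrite !inE.
by do 2 case: ifP => //=.
Qed.

(** Truncating the exponents at L replaces X / (1 - X) by (X - X^(L+1)) / (1 - X). After
    multiplication by (1 - X)^d the error is a multiple of X^(L+1), invisible in degree m <= L. *)
Lemma box_hilbert_numerator (n : nat) (H : rel 'I_n) (L m : nat) :
  (m <= L)%N ->
  \sum_(j < m.+1) ((1 - 'X) ^+ indep_number H : {poly int})`_j *
     (box_hilbert H L (m - j))%:Z = (indep_hvector int H)`_m.
Proof.
move=> mL; set d := indep_number H.
set F : {poly int} := \sum_(e in indep_box H L) 'X^(mdeg (box_mnm e)).
transitivity (((1 - 'X) ^+ d * F)`_m).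
  by rewrite coefM; apply: eq_bigr => j _; rewrite coef_sum_box natz.
apply/eqP; rewrite -subr_eq0 -coefB; apply/eqP.
suff [r ->] : exists r, (1 - 'X) ^+ d * F - indep_hvector int H = 'X^(L.+1) * r.
  by rewrite coefXnM ltnS mL.
rewrite /F sum_box_mdeg mulr_sumr -sumrB.
have geo : (1 - 'X) * \sum_(j < L) 'X^(j.+1) = 'X - 'X^(L.+1) :> {poly int}.
  rewrite mulr_sumr.
  rewrite (eq_bigr (fun j : 'I_L => 'X^(j.+1) - 'X^(j.+2))); last first.
    by move=> j _; rewrite mulrBl mul1r -exprS.
  rewrite -(big_mkord predT (fun j => 'X^(j.+1) - 'X^(j.+2))).
  rewrite -[RHS]opprB -(telescope_sumr (fun j => 'X^(j.+1)) (leq0n L)) -sumrN.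
  by apply: eq_bigr => j _; rewrite opprB.
have ex (A : {set 'I_n}) : independent H A -> exists r : {poly int},
    (1 - 'X) ^+ d * (\sum_(j < L) 'X^(j.+1)) ^+ #|A| -
    'X^#|A| * (1 - 'X) ^+ (d - #|A|) = 'X^(L.+1) * r.
  move=> indA; have /subnK dE : (#|A| <= d)%N := leq_indep_number indA.
  rewrite -{1}dE exprD -mulrA.
  rewrite -exprMn geo ['X^_ * _]mulrC -mulrBr subrXX addrAC subrr add0r.
  rewrite mulNr mulrN mulrCA -mulrN; by eexists.
elim/big_rec: _ => [|A p indA [r ->]]; first by exists 0; rewrite mulr0.
by have [s ->] := ex A indA; exists (s + r); rewrite mulrDr.
Qed.

(** * The monomial basis of the edge ring *)

Section EdgeRing.
Variables (k : fieldType) (n : nat) (H : rel 'I_n).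

Lemma edge_projZ (c : k) (p : {mpoly k[n]}) :
  edge_proj H (c *: p) = c *: edge_proj H p.
Proof. by rewrite -mul_mpolyC rmorphM. Qed.

Lemma edge_proj_eq0_ideal (p : {mpoly k[n]}) :
  (edge_proj H p == 0) = (p \in edge_ideal k H).
Proof.
rewrite -[p in RHS]subr0 Quotient.idealrBE.
by rewrite -(rmorph0 (@edge_proj k n H)) /edge_proj.
Qed.

Lemma edge_proj_repr (a : edge_ring k H) : edge_proj H (repr a) = a.
Proof. exact: reprK. Qed.

(** I(H) is a monomial ideal, spanned by the monomials whose support contains an edge. *)
Lemma edge_proj_eq0 (p : {mpoly k[n]}) : irreflexive H ->
  edge_proj H p = 0 <-> (forall m, independent H (mnm_supp m) -> p@_m = 0).
Proof.
move=> Hirr; split=> [/eqP|p0].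
  rewrite edge_proj_eq0_ideal => /asboolP[s [sX ->]] m indm.
  rewrite raddf_sum big1_seq // => x /andP[_ /sX [i [j [Hij ->]]]] /=.
  apply/eqP; rewrite -mpolyXD mcoeff_eq0 (perm_mem (msuppMX _ _)).
  apply/mapP=> -[m' _ mE]; have := forall_inP indm i.
  rewrite mE inE !mnmDE !mnm1E eqxx addnAC => /(_ isT)/forall_inP/(_ j).
  by rewrite inE !mnmDE !mnm1E eqxx addnAC addn1 Hij => /(_ isT).
apply/eqP; rewrite edge_proj_eq0_ideal (mpolyE p) rpred_sum // => m _.
have [/p0 ->|] := boolP (independent H (mnm_supp m)).
  by rewrite scale0r rpred0.
rewrite /independent negb_forall_in => /exists_inP[i mi].
rewrite negb_forall_in => /exists_inP[j mj]; rewrite negbK => Hij.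
have ij : i != j by apply: contraTneq Hij => ->; rewrite Hirr.
(* Since i and j are distinct, it is enough that each has a positive exponent in m. *)
have le_m : (U_(i) + U_(j) <= m)%MM.
  apply/mnm_lepP=> l; rewrite mnmDE !mnm1E.
  move: mi mj; rewrite !inE -!lt0n.
  case: (eqVneq i l) => [<-|]; last by case: (eqVneq j l) => [<-|].
  by rewrite eq_sym (negPf ij).
rewrite -(submK le_m) mpolyXD -mul_mpolyC mulrA.
apply/asboolP; exists [:: ((p@_(m - (U_(i) + U_(j)) + (U_(i) + U_(j)))%MM)%:MP *
  'X_[m - (U_(i) + U_(j))], 'X_i * 'X_j)].
split; last by rewrite big_seq1 -mpolyXD.
by move=> x; rewrite inE => /eqP ->; exists i, j.
Qed.

Lemma coef_sum_box_mnm (L i : nat)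
    (S := [set e in indep_box H L | mdeg (box_mnm e) == i])
    (c : 'I_#|S| -> k) (j : 'I_#|S|) :
  (\sum_l c l *: 'X_[box_mnm (enum_val l)] : {mpoly k[n]})
    @_(box_mnm (enum_val j)) = c j.
Proof.
rewrite raddf_sum (bigD1 j) //= mcoeffZ mcoeffX eqxx mulr1.
rewrite big1 ?addr0 // => l lj.
rewrite mcoeffZ mcoeffX (inj_eq (@box_mnm_inj _ _)) (inj_eq enum_val_inj).
by rewrite (negPf lj) mulr0.
Qed.

(** The classes of the degree i monomials with independent support form a basis; by [edge_proj_eq0],
    coordinates are coefficients of any lift. *)
Lemma edge_ring_degree_dim (L i : nat) : irreflexive H -> (i <= L)%N ->
  has_dimension (@edge_ring_degree k n H i) (box_hilbert H L i).
Proof.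
move=> Hirr iL; set S := [set e in indep_box H L | mdeg (box_mnm e) == i].
have bE (c : 'I_#|S| -> k) :
    \sum_j c j *: edge_proj H 'X_[box_mnm (enum_val j)] =
    edge_proj H (\sum_j c j *: 'X_[box_mnm (enum_val j)]).
  by rewrite raddf_sum; apply: eq_bigr => j _ /=; rewrite edge_projZ.
have SP (j : 'I_#|S|) :
    independent H (mnm_supp (box_mnm (enum_val j))) /\
    mdeg (box_mnm (enum_val j)) = i.
  by have := enum_valP j; rewrite !inE => /andP[-> /eqP].
exists (fun j => edge_proj H 'X_[box_mnm (enum_val j)]); split.
  move=> v; split=> [[p hp ->]|[c ->]]; last first.
    rewrite bE; eexists; last by [].
    apply: rpred_sum => j _; apply: dhomogZ; rewrite dhomogX.
    by apply/eqP; case: (SP j).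
  exists (fun j => p@_(box_mnm (enum_val j))); rewrite bE.
  apply/eqP; rewrite -subr_eq0 -rmorphB; apply/eqP/edge_proj_eq0 => // m indm.
  rewrite mcoeffB; apply/eqP; rewrite subr_eq0; apply/eqP.
  have [mi|mi] := eqVneq (mdeg m) i; last first.
    rewrite (dhomog_nemf_coeff hp mi) raddf_sum big1 // => j _ /=.
    rewrite mcoeffZ mcoeffX (negPf (_ : _ != m)) ?mulr0 //.
    by apply: contra_neq mi => <-; case: (SP j).
  have /box_mnmP[e me] : (mdeg m <= L)%N by rewrite mi.
  have eS : e \in S by rewrite !inE me indm mi eqxx.
  by rewrite -me -(enum_rankK_in eS eS) (coef_sum_box_mnm (L := L)).
move=> c; rewrite bE => /edge_proj_eq0-/(_ Hirr) c0 j.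
by rewrite -(c0 _ (proj1 (SP j))) (coef_sum_box_mnm (L := L)).
Qed.

End EdgeRing.

(** * Linear algebra: the dimension is well defined *)

Lemma exists_left_kernel (k : fieldType) (r s : nat) (M : 'M[k]_(r, s)) :
  (s < r)%N -> exists2 c : 'rV[k]_r, c != 0 & c *m M = 0.
Proof.
move=> sr; have /rowV0Pn[c cker c0] : kermx M != 0.
  by rewrite kermx_eq0 -row_leq_rank -ltnNge (leq_ltn_trans (rank_leq_col M)).
by exists c => //; apply/sub_kermxP.
Qed.

Lemma has_dimension_le (k : fieldType) (V : lmodType k) (W : V -> Prop)
    (r s : nat) :
  has_dimension W r -> has_dimension W s -> (r <= s)%N.
Proof.
move=> [b [bW b_free]] [b' [b'W _]]; rewrite leqNgt; apply/negP=> sr.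
have /choice[M bM] : forall i, exists c : 'I_s -> k, b i = \sum_j c j *: b' j.
  move=> i; apply/b'W/bW; exists (fun j => (i == j)%:R).
  rewrite (bigD1 i) //= eqxx scale1r big1 ?addr0 // => j.
  by rewrite eq_sym => /negPf ->; rewrite scale0r.
have [c c0 cM] := exists_left_kernel (\matrix_(i, j) M i j) sr.
case/negP: c0; apply/eqP/rowP=> i; rewrite mxE; apply: b_free i.
rewrite (eq_bigr (fun i => \sum_j (c 0 i * M i j) *: b' j)); last first.
  by move=> i _; rewrite bM scaler_sumr; apply: eq_bigr => j _; rewrite scalerA.
rewrite exchange_big big1 //= => j _; rewrite -scaler_suml.
have := congr1 (fun A : 'rV_s => A 0 j) cM; rewrite !mxE => cMj.
rewrite (eq_bigr (fun i => c 0 i * (\matrix_(i, j) M i j) i j)).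
  by rewrite cMj scale0r.
by move=> i _; rewrite mxE.
Qed.

Lemma has_dimension_unique (k : fieldType) (V : lmodType k) (W : V -> Prop)
    (r s : nat) :
  has_dimension W r -> has_dimension W s -> r = s.
Proof.
by move=> Wr Ws; apply/eqP; rewrite eqn_leq !(has_dimension_le (W := W)).
Qed.

(** * Upper bound on the Krull dimension *)

Section PolynomialValue.
Variables (k : fieldType) (N : nat).

(* [\sum_s c s * x_1 ^+ s_1 * ... * x_m ^+ s_m], over the exponent sequences *)
(* [s] with entries [< N].                                                    *)
Fixpoint multi_horner (A : lalgType k) (xs : seq A) (c : seq nat -> k) : A :=
  if xs is x :: xs' then
    \sum_(j < N) x ^+ j * multi_horner xs' (fun s => c (val j :: s))
  else (c [::])%:A.

Lemma multi_horner0 (A : lalgType k) (xs : seq A) (c : seq nat -> k) :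
  (forall s, size s = size xs -> all (gtn N) s -> c s = 0) ->
  multi_horner xs c = 0.
Proof.
elim: xs c => [|x xs IH] c c0 /=; first by rewrite c0 // scale0r.
rewrite big1 // => j _; rewrite IH ?mulr0 // => s ss sN.
by rewrite c0 //= ?ss // ltn_ord.
Qed.

Lemma multi_horner_sum (A : algType k) (I : finType) (xs : seq A) (a : I -> k)
    (c : I -> seq nat -> k) :
  multi_horner xs (fun s => \sum_i a i * c i s) =
  \sum_i a i *: multi_horner xs (c i).
Proof.
elim: xs c => [|x xs IH] c /=.
  by rewrite scaler_suml; apply: eq_bigr => i _; rewrite scalerA.
rewrite [RHS](eq_bigr (fun i => \sum_(j < N)
  x ^+ j * (a i *: multi_horner xs (fun s => c i (val j :: s))))).
  rewrite exchange_big; apply: eq_bigr => j _ /=.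
  by rewrite IH mulr_sumr.
by move=> i _; rewrite scaler_sumr; apply: eq_bigr => j _; rewrite -scalerAr.
Qed.

(* [g 0] lies in [Q] as [x] does, so it is zero; then [x] cancels modulo [P].  *)
Lemma prime_ideal_relation (A : comNzRingType) (P Q : {pred A}) (x : A)
    (M : nat) (g : nat -> A) :
  prime_ideal P -> prime_ideal Q -> {subset P <= Q} -> x \notin P -> x \in Q ->
  (forall j, (j < M)%N -> g j \in Q -> g j = 0) ->
  \sum_(j < M) x ^+ j * g j \in P -> forall j, (j < M)%N -> g j = 0.
Proof.
move=> [[_ _ _] Pprime] [[_ _ Qlin] _] PQ xP xQ.
elim: M g => // M IH g g0; rewrite big_ord_recl expr0 mul1r /=.
set S := \sum_(j < M) _; set S' := \sum_(j < M) x ^+ j * g j.+1.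
have SE : S = S' * x.
  by rewrite mulr_suml; apply: eq_bigr => j _; rewrite exprSr mulrAC.
rewrite SE => gP.
have g00 : g 0 = 0.
  apply: g0 => //; rewrite (_ : g 0 = - S' * x + (g 0 + S' * x)).
    by apply: Qlin => //; apply: PQ.
  by rewrite mulNr addrC addrK.
have S'P : S' \in P.
  move: gP; rewrite g00 add0r => /Pprime /orP[//|].
  by rewrite (negPf xP).
have gS : forall j, (j < M)%N -> g j.+1 = 0.
  by apply: (IH (fun j => g j.+1)) => // j jM; apply: g0.
by case.
Qed.

(** Expand the value in powers of the first element x. By induction on the shifted chain, a
    coefficient lying in P_1 has only zero scalars, hence is 0; [prime_ideal_relation] then kills
    all coefficients of x, and induction applies again to each. In the base case, a nonzero scalar
    is a unit and cannot lie in P_0. *)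
Lemma prime_chain_independent (A : comAlgType k) (P : nat -> {pred A})
    (xs : seq A) (c : seq nat -> k) :
  prime_chain (size xs) P ->
  (forall i, (i < size xs)%N -> xs`_i \notin P i /\ xs`_i \in P i.+1) ->
  multi_horner xs c \in P 0%N ->
  forall s, size s = size xs -> all (gtn N) s -> c s = 0.
Proof.
elim: xs P c => [|x xs IH] P c [Pprime Psub] xsP /=.
  move=> c0 s /size0nil -> _; apply/eqP; apply: contraTT isT => cn0.
  have [[P0 P1 Plin] _] := Pprime 0%N isT.
  case/negP: P1; have := Plin (c [::])^-1%:A _ _ c0 P0.
  by rewrite addr0 -scalerAl mul1r scalerA mulVf // scale1r.
have chainS : prime_chain (size xs) (fun i => P i.+1).
  by split=> i ilt; [apply: Pprime | apply: Psub].
have xsS i : (i < size xs)%N -> xs`_i \notin P i.+1 /\ xs`_i \in P i.+2.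
  exact: (xsP i.+1).
have {}IH c' := IH _ c' chainS xsS.
have [x0 x1] := xsP 0%N isT; have [sub01 _] := Psub 0%N isT.
move=> /(prime_ideal_relation
  (g := fun j => multi_horner xs (fun s => c (j :: s)))
  (Pprime 0%N isT) (Pprime 1%N isT) sub01 x0 x1) g0.
case=> // j s [ss] /= /andP[jN sN].
have gj : multi_horner xs (fun s => c (j :: s)) \in P 1%N.
  rewrite g0 //; first by have [[]] := Pprime 1%N isT.
  by move=> i iN /IH gi; apply: multi_horner0.
exact: (IH _ gj).
Qed.

Lemma msize_mul_le (n a b : nat) (p q : {mpoly k[n]}) :
  (msize p <= a.+1 -> msize q <= b.+1 -> msize (p * q) <= (a + b).+1)%N.
Proof.
move=> pa qb; have [->|p0] := eqVneq p 0; first by rewrite mul0r msize0.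
have [->|q0] := eqVneq q 0; first by rewrite mulr0 msize0.
rewrite msizeM_proper ?mulf_neq0 ?mleadc_eq0 //.
have -> : (a + b).+1 = (a.+1 + b.+1).-1 by rewrite addSn addnS.
by rewrite -!subn1 leq_sub2r // leq_add.
Qed.

(** Each of the [size fs] power factors has degree at most N D; [msize] is the degree plus one. *)
Lemma msize_multi_horner (n D : nat) (fs : seq {mpoly k[n]})
    (c : seq nat -> k) :
  all (fun f => msize f <= D.+1)%N fs ->
  (msize (multi_horner fs c) <= (size fs * (N * D)).+1)%N.
Proof.
elim: fs c => [|f fs IH] c /=.
  by move=> _; rewrite alg_mpolyC msizeC; case: (_ == _).
case/andP=> fD fsD; apply: leq_trans (msize_sum _ _ _) _.
apply/bigmax_leqP => j _; rewrite mulSn; apply: msize_mul_le (IH _ fsD).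
have exp_le i : (msize (f ^+ i) <= (i * D).+1)%N.
  elim: i => [|i IHi]; first by rewrite expr0 msize1.
  by rewrite exprS mulSn; apply: msize_mul_le.
by apply: leq_trans (exp_le j) _; rewrite ltnS leq_mul2r ltnW ?orbT.
Qed.

Lemma edge_proj_multi_horner (n : nat) (H : rel 'I_n) (fs : seq {mpoly k[n]})
    (c : seq nat -> k) :
  edge_proj H (multi_horner fs c) =
  multi_horner [seq edge_proj H f | f <- fs] c.
Proof.
elim: fs c => [|f fs IH] c /=; first by rewrite edge_projZ rmorph1.
rewrite raddf_sum; apply: eq_bigr => j _ /=.
by rewrite rmorphM rmorphXn /= IH.
Qed.

End PolynomialValue.

(* There are [N ^ (d + 1)] monomials with exponents [< N] in the [d + 1]      *)
(* elements, but their span has dimension [O(N ^ d)].                         *)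
Lemma edge_ring_dependent (k : fieldType) (n : nat) (H : rel 'I_n)
    (fs : seq {mpoly k[n]}) :
  irreflexive H -> size fs = (indep_number H).+1 ->
  exists N (c : seq nat -> k) (s : seq nat),
    [/\ edge_proj H (multi_horner N fs c) = 0, size s = size fs,
        all (gtn N) s & c s != 0].
Proof.
move=> Hirr; set d := indep_number H => sfs.
pose D := \max_(f <- fs) msize f.
have fsD : all (fun f => msize f <= D.+1)%N fs.
  by apply/allP => f ffs; apply: leqW; rewrite /D (big_rem f) //= leq_maxl.
(* All products have degree at most L, and L + 1 <= K N. The relevant monomials thus number at most
   2^n K^d N^d < N^(d+1), by the choice of N. *)
pose K := (d.+1 * D).+1.
pose N := (2 ^ n * K ^ d).+1.
pose L := (size fs * (N * D))%N.
pose T : finType := (size fs).-tuple 'I_N.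
pose e (t : T) : seq nat := [seq val i | i <- t].
have e_inj : injective e.
  by move=> t t' /(inj_map val_inj) /val_inj.
pose mono (t : T) := multi_horner N fs (fun s => (e t == s)%:R : k).
(* A left kernel vector is a combination of the products whose coefficients at all these monomials
   vanish, so it is zero in the edge ring. *)
pose M := \matrix_(i < #|T|, j < #|indep_box H L|)
  (mono (enum_val i))@_(box_mnm (enum_val j)).
have lt_card : (#|indep_box H L| < #|T|)%N.
  apply: leq_ltn_trans (card_indep_box H L) _; rewrite -/d.
  rewrite card_tuple card_ord sfs expnS.
  apply: (@leq_ltn_trans (2 ^ n * (K * N) ^ d)%N).
    rewrite leq_mul2l; apply/orP; right.
    have : (L.+1 <= K * N)%N.
      rewrite /L /K sfs [X in (_ <= X)%N]mulSn -mulnA (mulnC D) -add1n.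
      by rewrite leq_add2r.
    by case: (posnP d) => [->//|d0]; rewrite leq_exp2r.
  by rewrite expnMn mulnA ltn_mul2r expn_gt0 /= ltnS leqnn.
have [v v0 vM] := exists_left_kernel M lt_card.
pose c s := \sum_i v 0 i * (e (enum_val i) == s)%:R.
have [i vi] : exists i, v 0 i != 0.
  apply/existsP; apply: contraNT v0; rewrite negb_exists => /forallP v0.
  by apply/eqP/rowP=> i; rewrite mxE; apply/eqP; rewrite -[_ == _]negbK v0.
exists N, c, (e (enum_val i)); split.
- rewrite /c multi_horner_sum; apply/edge_proj_eq0 => // m indm.
  have [mL|mL] := leqP (mdeg m) L; last first.
    rewrite -multi_horner_sum; apply: memN_msupp_eq0; apply: msize_mdeg_ge.
    exact: leq_trans (msize_multi_horner _ _ fsD) _.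
  have [b bm] := box_mnmP mL; have bS : b \in indep_box H L by rewrite inE bm.
  have := congr1 (fun A : 'rV_#|indep_box H L| => A 0 (enum_rank_in bS b)) vM.
  rewrite !mxE => <-; rewrite raddf_sum; apply: eq_bigr => j _ /=.
  by rewrite mcoeffZ !mxE enum_rankK_in // bm.
- by rewrite size_map size_tuple.
- by apply/allP => _ /mapP[j _ ->]; rewrite /= ltn_ord.
rewrite /c (bigD1 i) //= eqxx mulr1 big1 ?addr0 // => j ji.
by rewrite (inj_eq e_inj) (inj_eq enum_val_inj) (negPf ji) mulr0.
Qed.

(** A chain longer than d yields x_0, ..., x_d with x_i in P_(i+1) but not in P_i: independent by
    [prime_chain_independent], dependent by [edge_ring_dependent]. *)
Lemma edge_ring_chain_le (k : fieldType) (n : nat) (H : rel 'I_n) (e : nat)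
    (P : nat -> {pred edge_ring k H}) :
  irreflexive H -> prime_chain e P -> (e <= indep_number H)%N.
Proof.
move=> Hirr [Pprime Psub]; rewrite leqNgt; apply/negP; set d := indep_number H.
move=> de.
have /choice[x xP] : forall i, exists x,
    (i < e)%N -> x \notin P i /\ x \in P i.+1.
  move=> i; have [ie|] := ltnP i e; last by exists 0.
  have [_ /existsNP[x /not_implyP[x1 x0]]] := Psub i ie.
  by exists x; split=> //; apply/negP.
pose fs := [seq repr (x i) | i <- iota 0 d.+1].
have sfs : size fs = d.+1 by rewrite size_map size_iota.
have [N [c [s [fs0 ss sN /eqP]]]] := edge_ring_dependent Hirr sfs.
apply; have fsE : [seq edge_proj H f | f <- fs] = [seq x i | i <- iota 0 d.+1].
  by rewrite -map_comp; apply: eq_map => i /=; rewrite edge_proj_repr.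
move: fs0; rewrite edge_proj_multi_horner fsE => fs0.
have sxs : size [seq x i | i <- iota 0 d.+1] = d.+1.
  by rewrite size_map size_iota.
apply: (@prime_chain_independent k N _ P [seq x i | i <- iota 0 d.+1]) sN.
- rewrite sxs; split=> i ilt; first by apply: Pprime; apply: leq_trans de.
  by apply: Psub; apply: leq_trans de.
- move=> i; rewrite sxs => id; rewrite (nth_map 0%N) ?size_iota // nth_iota //.
  by apply: xP; apply: leq_trans de.
- by rewrite fs0; have [[]] := Pprime 0%N isT.
by rewrite ss sfs sxs.
Qed.

(** * Lower bound on the Krull dimension *)

Section FacePrimes.
Variables (k : fieldType) (n : nat) (H : rel 'I_n).

Definition face_proj (W : {set 'I_n}) (p : {mpoly k[n]}) : {mpoly k[n]} :=
  p \mPo [tuple if i \in W then 'X_i else 0 | i < n].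

Lemma mcoeff_face_proj (W : {set 'I_n}) (p : {mpoly k[n]}) (m : 'X_{1..n}) :
  (face_proj W p)@_m = if mnm_supp m \subset W then p@_m else 0.
Proof.
have projX m' :
    face_proj W 'X_[m'] = if mnm_supp m' \subset W then 'X_[m'] else 0.
  rewrite /face_proj comp_mpolyX.
  case: ifPn => [/subsetP sub|/subsetPn[i im iW]].
    rewrite mpolyXE_id; apply: eq_bigr => i _; rewrite tnth_mktuple.
    have := sub i; rewrite inE; case: eqP => [-> _|_ ->//].
    by rewrite !expr0.
  rewrite (bigD1 i) //= tnth_mktuple (negPf iW) expr0n.
  by move: im; rewrite inE => /negPf ->; rewrite mul0r.
rewrite [face_proj W p]comp_mpolyEX raddf_sum /=.
rewrite (eq_bigr (fun m' => if mnm_supp m \subset W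
    then (p@_m' *: 'X_[m'])@_m else 0)); last first.
  move=> m' _; rewrite !mcoeffZ -/(face_proj W _) projX.
  rewrite mcoeffX; have [<-|mm] := eqVneq m' m.
    by case: ifP; rewrite ?mcoeffX ?eqxx ?mcoeff0 ?mulr0.
  rewrite mulr0 if_same.
  by case: ifP; rewrite ?mcoeffX ?(negPf mm) ?mcoeff0 mulr0.
case: ifP => _; last by rewrite big1.
by rewrite -raddf_sum -mpolyE.
Qed.

Lemma independentS (A B : {set 'I_n}) :
  A \subset B -> independent H B -> independent H A.
Proof.
move=> /subsetP AB /forall_inP indB; apply/forall_inP => x /AB xB.
by apply/forall_inP => y /AB yB; apply: (forall_inP (indB _ xB)).
Qed.

(* The prime ideal generated by the variables outside the face [W]. *)
Definition face_prime (W : {set 'I_n}) : {pred edge_ring k H} :=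
  fun a => face_proj W (repr a) == 0.

(** Membership does not depend on the lift: two lifts differ by an element of I(H), which has no
    monomial supported in the independent set [W]. *)
Lemma face_primeE (W : {set 'I_n}) (p : {mpoly k[n]}) :
  irreflexive H -> independent H W ->
  (edge_proj H p \in face_prime W) = (face_proj W p == 0).
Proof.
move=> Hirr indW; rewrite unfold_in /face_prime; congr (_ == 0).
apply/mpolyP=> m; rewrite !mcoeff_face_proj; case: ifP => // mW.
apply/eqP; rewrite -subr_eq0 -mcoeffB; apply/eqP.
have : edge_proj H (repr (edge_proj H p) - p) = 0.
  by rewrite rmorphB /= edge_proj_repr subrr.
by move/edge_proj_eq0; apply=> //; apply: independentS indW.
Qed.

Lemma face_prime_ideal (W : {set 'I_n}) :
  irreflexive H -> independent H W -> prime_ideal (face_prime W).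
Proof.
move=> Hirr indW; have inE := face_primeE _ Hirr indW.
split; first split.
- by rewrite -(rmorph0 (edge_proj H)) inE /face_proj rmorph0.
- by rewrite -(rmorph1 (edge_proj H)) inE /face_proj rmorph1 oner_eq0.
- move=> a u v.
  rewrite -(edge_proj_repr a) -(edge_proj_repr u) -(edge_proj_repr v).
  rewrite -rmorphM -rmorphD !inE /face_proj rmorphD rmorphM.
  move=> /eqP /= -> /eqP ->.
  by rewrite mulr0 addr0.
move=> u v; rewrite -(edge_proj_repr u) -(edge_proj_repr v).
by rewrite -rmorphM !inE /face_proj rmorphM mulf_eq0.
Qed.

Lemma face_prime_sub (V W : {set 'I_n}) :
  V \subset W -> {subset face_prime W <= face_prime V}.
Proof.
move=> VW a; rewrite !unfold_in => /eqP aW; apply/eqP/mpolyP=> m.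
rewrite mcoeff_face_proj mcoeff0; case: ifP => // mV.
have := congr1 (mcoeff m) aW.
by rewrite mcoeff_face_proj mcoeff0 (subset_trans mV).
Qed.

Lemma face_prime_var (W : {set 'I_n}) (i : 'I_n) :
  irreflexive H -> independent H W ->
  (edge_proj H 'X_i \in face_prime W) = (i \notin W).
Proof.
move=> Hirr indW; rewrite face_primeE // /face_proj comp_mpolyXU.
rewrite -tnth_nth tnth_mktuple; case: (i \in W); last exact: eqxx.
by apply/negbTE/eqP => /(congr1 (mcoeff U_(i)%MM))/eqP;
  rewrite mcoeffX mcoeff0 eqxx oner_eq0.
Qed.

(** Remove the vertices of a largest independent set one at a time: the variable of the vertex
    removed at step i enters the face prime exactly there, so all d inclusions are strict. *)
Lemma edge_ring_chain_exists :
  irreflexive H ->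
  exists P : nat -> {pred edge_ring k H}, prime_chain (indep_number H) P.
Proof.
move=> Hirr; have [A indA cardA] := indep_numberP H.
pose W i := [set x in drop i (enum A)].
have WS i : W i.+1 \subset W i.
  apply/subsetP=> x; rewrite !inE -addn1 addnC -drop_drop.
  exact: mem_drop.
have indW i : independent H (W i).
  apply: independentS indA; apply/subsetP=> x; rewrite inE => /mem_drop.
  by rewrite mem_enum.
exists (fun i => face_prime (W i)); split=> [i _|i ilt].
  exact: face_prime_ideal.
split; first exact: face_prime_sub.
rewrite -cardA cardE in ilt.
have [x0 _] : exists x0, x0 \in A.
  by apply/card_gt0P; rewrite cardE (leq_trans _ ilt).
have xW : (nth x0 (enum A) i) \in W i by rewrite inE (drop_nth x0 ilt) mem_head.
move=> /(_ (edge_proj H 'X_(nth x0 (enum A) i))); rewrite !face_prime_var // xW.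
have := drop_uniq i (enum_uniq A); rewrite (drop_nth x0 ilt) /= => /andP[xS _].
by rewrite inE xS => /(_ isT).
Qed.

End FacePrimes.

(** * The a-invariant and the theorem *)

Lemma edge_ring_krull_dim (k : fieldType) (n : nat) (H : rel 'I_n) :
  irreflexive H -> is_krull_dim (edge_ring k H) (indep_number H).
Proof.
move=> Hirr; split; first exact: edge_ring_chain_exists.
by move=> e P; apply: edge_ring_chain_le.
Qed.

Lemma krull_dim_unique (A : comNzRingType) (d e : nat) :
  is_krull_dim A d -> is_krull_dim A e -> d = e.
Proof.
move=> [[P Pd] maxd] [[Q Qe] maxe]; apply/eqP.
by rewrite eqn_leq (maxe _ _ Pd) (maxd _ _ Qe).
Qed.

Lemma edge_a_invariantE (k : fieldType) (n : nat) (H : rel 'I_n) :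
  irreflexive H -> edge_a_invariant k H = - (indep_mult H)%:Z.
Proof.
move=> Hirr; set d := indep_number H.
have HFdim : is_hilbert_function (@edge_ring_degree k n H)
    (fun i => box_hilbert H i i).
  by move=> i; apply: edge_ring_degree_dim.
(* The Cauchy product in degree m needs one common box L = m; uniqueness of dimension makes the
   count independent of the box. *)
have HFbox L i : (i <= L)%N -> box_hilbert H L i = box_hilbert H i i.
  move=> iL; apply: has_dimension_unique (HFdim i).
  exact: edge_ring_degree_dim.
have num : is_hilbert_numerator (fun i => box_hilbert H i i) d
    (indep_hvector int H).
  move=> m; rewrite -(@box_hilbert_numerator n H m m) //.
  by apply: eq_bigr => j _; rewrite (HFbox m) ?leq_subr.
have [Md size_h] := size_indep_hvector H.
apply: classical_sets.xget_unique.
  exists (fun i => box_hilbert H i i), d, (indep_hvector int H); split=> //.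
    exact: edge_ring_krull_dim.
  by rewrite size_h -/d /= -subzn // addrAC subrr add0r.
(* Uniqueness: the algebra determines the Hilbert function and the dimension, and these determine
   every coefficient of the numerator. *)
move=> a [HF [e [h [HFd ek hnum ->]]]].
have ed : e = d by apply: krull_dim_unique ek _; apply: edge_ring_krull_dim.
rewrite {}ed in hnum *.
have -> : h = indep_hvector int H.
  apply/polyP=> m; rewrite -num -hnum; apply: eq_bigr => j _.
  by congr (_ * Posz _); apply: has_dimension_unique (HFd _) (HFdim _).
by rewrite size_h -/d /= -subzn // addrAC subrr add0r.
Qed.

Theorem proposition3p6 (k : fieldType) (n : nat) (hn : (1 <= n)%N)
  (G : rel 'I_n) (Gsym : symmetric G) (Girr : irreflexive G)
  (Gniso : no_isolated G)
  (C : {set 'I_n}) (hC : minimal_vertex_cover G C)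
  (u : nat) (hu : u = #|~: C|)
  (q : {poly rat})
  (hq : indep_poly G = (1 + 'X) ^+ indep_mult G * (q \Po (1 + 'X)))
  (hq0 : q.[0] != 0) :
  (* (a) *)
  [/\ (indep_mult G < u)%N -> indep_mult (suspension G C) = indep_mult G,
      (u < indep_mult G)%N -> indep_mult (suspension G C) = u,
      indep_mult G = u -> (u <= indep_mult (suspension G C))%N
    & (u < indep_mult (suspension G C))%N <->
        (indep_mult G = u /\ q.[0] = 1)] /\
  (* (b) *)
  ((- u%:Z < edge_a_invariant k G ->
      edge_a_invariant k (suspension G C) = edge_a_invariant k G) /\
   (edge_a_invariant k G < - u%:Z ->
      edge_a_invariant k (suspension G C) = - u%:Z)).

Proof.
have cov : vertex_cover G C by have [] := minsetP hC.
have Sirr : irreflexive (suspension G C).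
  by move=> a; rewrite /suspension; case: unlift.
have := indep_mult_suspension cov hq hq0; rewrite -hu => partA.
split=> //; have [lt gt _ _] := partA.
(* Negation reverses the inequalities, so (b) becomes the two strict cases of (a). *)
rewrite !edge_a_invariantE // !ltrN2 !ltz_nat.
by split=> [/lt ->|/gt ->].
Qed.
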